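(* Let $(M=G/H,ds^2)$ be a connected pseudo-Riemannian $G$-geodesic orbit nilmanifold, where $G=N\rtimes H$ with $N$ nilpotent, let $\mathfrak n=\mathrm{Lie}(N)$ with induced inner product $\langle\cdot,\cdot\rangle$, $\mathfrak d=[\mathfrak n,\mathfrak n]$ and $\mathfrak v=\mathfrak d^\perp$. Suppose $\mathfrak d$ is nondegenerate Lorentzian and $\operatorname{ind}\mathfrak v\le 2$. Then either $\mathfrak n$ is at most two-step nilpotent, or $\operatorname{ind}\mathfrak v=2$ and $$L=Q^\perp\subset Q\subset\mathfrak v$$ is an $\mathfrak h$-invariant maximal totally isotropic two-plane of $\mathfrak v$, with $Q/L$ positive definite. Here $Q=\ker\omega=\{Y\in\mathfrak v:\omega(Y,Y')=0\ \text{for all } Y'\in\mathfrak v\}$, where $\omega$ is the $2$-form on $\mathfrak v$ given by $\omega(Y_1,Y_2)=\langle[Y_1,Y_2],e_m\rangle$ with $e_m\in\mathfrak d$ the null vector described in the context, and $Q^\perp$ is taken inside $\mathfrak v$.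
   Context: Setting: $N$ is a connected nilpotent Lie group with (real, finite-dimensional) Lie algebra $\mathfrak n$, equipped with a left-invariant pseudo-Riemannian metric $ds^2$ given by a nondegenerate symmetric bilinear form (''inner product'') $\langle\cdot,\cdot\rangle$ on $\mathfrak n$; $H$ is a connected Lie group of automorphisms of $N$ preserving $ds^2$; $G=N\rtimes H$ acts on $M=G/H\cong N$ by isometries. Thus $\mathfrak g=\mathfrak h\oplus\mathfrak n$ is a reductive decomposition, and $\mathfrak h=\mathrm{Lie}(H)$ is identified with a Lie algebra of derivations of $\mathfrak n$ that are skew-adjoint with respect to $\langle\cdot,\cdot\rangle$; for $A\in\mathfrak h$, $X\in\mathfrak n$ write $AX=[A,X]$. $M$ is $G$-geodesic orbit (GO) if every geodesic is an orbit of a one-parameter subgroup of $G$. By the Geodesic Lemma this is equivalent to: for every $T\in\mathfrak n$ there exist $A\in\mathfrak h$ and $k\in\mathbb R$ such that $\langle [T,T']+AT',\,T\rangle=k\langle T,T'\rangle$ for all $T'\in\mathfrak n$. The index $\operatorname{ind}$ of a symmetric bilinear form is its number of negative squares. Lorentzian means signature $(m-1,1)$ with $m=\dim\mathfrak d\ge2$. Choice of $e_m$: since $\mathfrak d$ is nondegenerate Lorentzian and $M$ is GO, the operators $\mathrm{ad}(T)|_{\mathfrak d}$, $T\in\mathfrak n$, are skew-adjoint and nilpotent, and there is a Witt basis $e_1,\dots,e_m$ of $\mathfrak d$ (with $\langle e_1,e_m\rangle=1$, $\langle e_i,e_j\rangle=\delta_{ij}$ for $2\le i,j\le m-1$, all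 other pairings zero) and a linear map $\Psi:\mathfrak n\to W_0=\operatorname{Span}(e_2,\dots,e_{m-1})$ such that for all $T\in\mathfrak n$ $$[T,e_1]=\Psi T,\qquad [T,z]=-\langle\Psi T,z\rangle e_m\ (z\in W_0),\qquad [T,e_m]=0 .$$ Fix such a basis; then $\omega(Y_1,Y_2)$ is the $e_1$-coefficient of $[Y_1,Y_2]$. When $\Psi\neq0$, the line $\mathbb R e_m$ is the radical of $[\mathfrak v,\mathfrak d]$, so $Q$ does not depend on the choice. *)

(* Defs.v *)
From HB Require Import structures.
From mathcomp Require Export all_boot all_order all_algebra reals.

Set Implicit Arguments.
Unset Strict Implicit.
Unset Printing Implicit Defensive.

Import Order.TTheory GRing.Theory Num.Theory.
Local Open Scope ring_scope.

HB.mixin Record isLieAlgebra (R : fieldType) V of Vector R V := {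
  lie : V -> V -> V;
  lie_bilinear : bilinear_for *:%R *:%R lie;
  lie_alternating : forall x, lie x x = 0;
  lie_jacobi : forall x y z,
    lie x (lie y z) + lie y (lie z x) + lie z (lie x y) = 0
}.

#[short(type="lieAlgType")]
HB.structure Definition LieAlgebra (R : fieldType) :=
  { V of isLieAlgebra R V & Vector R V }.

Section LieAlgebras.
Variables (R : fieldType) (n : lieAlgType R).

HB.instance Definition _ :=
  bilinear_isBilinear.Build R n n n *:%R *:%R (@lie R n) lie_bilinear.

Lemma lieC (x y : n) : lie x y = - lie y x.
Proof.
apply/eqP; rewrite -addr_eq0; apply/eqP.
have := lie_alternating (x + y).
by rewrite linearDl !linearDr /= !lie_alternating add0r addr0.
Qed.

(* By bilinearity these brackets of basis vectors span all lie x y with x in U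
   and y in W, see lievP. *)
Definition liev (U W : {vspace n}) : {vspace n} :=
  <<[seq lie x y | x <- vbasis U, y <- vbasis W]>>%VS.

Lemma memv_liev (U W : {vspace n}) x y : x \in U -> y \in W -> lie x y \in liev U W.
Proof.
move=> /coord_vbasis-> /coord_vbasis->.
rewrite linear_sumlz; apply: memv_suml => i _.
rewrite linearZl_LR memvZ // linear_sumr; apply: memv_suml => j _.
rewrite linearZr_LR memvZ // memv_span //.
by apply: allpairs_f; rewrite mem_nth ?size_tuple.
Qed.

Lemma lievP (U W Z : {vspace n}) :
  reflect {in U & W, forall x y, lie x y \in Z} (liev U W <= Z)%VS.
Proof.
apply: (iffP idP) => [sZ x y xU yW | sZ].
  by apply: (subvP sZ); apply: memv_liev.
apply/span_subvP => _ /allpairsP[[x y] /= [xU yW ->]].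
by apply: sZ; apply: vbasis_mem.
Qed.

Fixpoint lower_central (i : nat) : {vspace n} :=
  if i is j.+1 then liev fullv (lower_central j) else fullv.

(* at most i-step nilpotent *)
Definition nilpotent_step i := lower_central i == 0%VS.

Definition nilpotent_lie := exists i, nilpotent_step i.

Definition derived : {vspace n} := liev fullv fullv.

Definition derivation (A : 'End(n)) :=
  forall x y, A (lie x y) = lie (A x) y + lie x (A y).

Definition lie_subalgebra_End (h : {vspace 'End(n)}) :=
  {in h &, forall A C, (A \o C)%VF - (C \o A)%VF \in h}.

End LieAlgebras.

Section Forms.
Variables (R : realType) (n : vectType R) (B : {symmetric n}).

Definition skew_adjoint (A : 'End(n)) := forall x y, B (A x) y = - B x (A y).

Definition nondegenerate_on (U : {vspace n}) := (U :&: orthov B U == 0)%VS.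

(* Numbers of positive and negative squares of the restriction of B to U; by
   Sylvester's law they do not depend on the orthogonal basis b. *)
Definition has_signature (U : {vspace n}) (p q : nat) :=
  exists b : seq n,
    [/\ basis_of U b, pairwise_orthogonal B b,
        count (fun x => 0 < B x x) b = p & count (fun x => B x x < 0) b = q].

Definition has_index U q := exists p, has_signature U p q.

Definition lorentzian (U : {vspace n}) :=
  (2 <= \dim U)%N /\ has_signature U (\dim U).-1 1%N.

Definition totally_isotropic (U : {vspace n}) := {in U &, forall x y, B x y = 0}.

Definition max_totally_isotropic (W U : {vspace n}) :=
  [/\ (U <= W)%VS, totally_isotropic U &
      forall U' : {vspace n},
        (U <= U' <= W)%VS -> totally_isotropic U' -> U' = U].

(* The first clause makes B descend to Q / L. *)
Definition posdef_quotient (Q L : {vspace n}) :=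
  (L <= orthov B Q)%VS /\ {in Q, forall x, x \notin L -> 0 < B x x}.

(* e1, w`_0, w`_1, ..., em is a Witt basis of U. *)
Definition witt_basis (U : {vspace n}) (e1 : n) (w : seq n) (em : n) :=
  [/\ basis_of U (e1 :: rcons w em),
      [/\ B e1 em = 1, B e1 e1 = 0 & B em em = 0],
      {in w, forall z, B e1 z = 0 /\ B em z = 0} &
      orthonormal B w].

End Forms.

Section GeodesicOrbit.
Variables (R : realType) (n : lieAlgType R) (B : {symmetric n}).

(* The geodesic orbit property of (N ><| H) / H on n = Lie N and h = Lie H.  By
   the Geodesic Lemma, the geodesic from the base point with velocity T is, up to
   reparametrization, the orbit of the one-parameter group of T + A; the scalar k
   (possibly nonzero for null T) accounts for the reparametrization. *)
Definition geodesic_orbit (h : {vspace 'End(n)}) :=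
  forall T : n, exists2 A, A \in h &
    exists k : R, forall T' : n, B (lie T T' + A T') T = k * B T T'.

Definition orth_derived : {vspace n} := orthov B (derived n).

(* The normal form of the operators ad T on the derived algebra; w spans W_0. *)
Definition adapted_basis (e1 : n) (w : seq n) (em : n) (Psi : 'End(n)) :=
  witt_basis B (derived n) e1 w em /\
  forall T, [/\ Psi T \in <<w>>%VS,
                lie T e1 = Psi T,
                {in <<w>>%VS, forall z, lie T z = - B (Psi T) z *: em} &
                lie T em = 0].

Variable em : n.

(* the e1-coefficient of lie x y, for em the last vector of an adapted basis *)
Definition omega (x y : n) : R := B (lie x y) em.

Lemma omega_bilinear : bilinear_for *%R (idfun \; *%R) omega.
Proof.
split=> [z|z] a x y; rewrite /omega /=.
  by rewrite linearPl /= linearPl.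
by rewrite linearPr /= linearPl.
Qed.

HB.instance Definition _ :=
  bilinear_isBilinear.Build R n n R *%R (idfun \; *%R) omega omega_bilinear.

Lemma omega_skew x y : omega x y = (-1) ^+ true * idfun (omega y x).
Proof. by rewrite /omega lieC linearNl expr1 mulN1r. Qed.

HB.instance Definition _ :=
  isHermitianSesquilinear.Build R n true idfun omega omega_skew.

Definition ker_omega : {vspace n} := (orth_derived :&: orthov omega orth_derived)%VS.

Definition ker_omega_perp : {vspace n} := (orth_derived :&: orthov B ker_omega)%VS.

End GeodesicOrbit.

(* Main.v *)
Require Import Defs.
From mathcomp Require Import ring lra.

(* Testing the geodesic orbit condition at X + Y (X in d, Y in v) against X and
   Y gives <[Y, X], X> = 0, so ad Y is skew on d for Y in v, hence for all Y in
   n because v generates n.  A null vector e_m of d killed by n exists (the last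
   nonzero term of the lower central series is isotropic when n is not
   two-step), and completing it to a Witt basis gives the normal form of ad(n)
   on d.

   If Psi <> 0, the Jacobi identity gives omega(y,z) Psi x + cyclic = 0 and
   <Psi x, [y,z]> + cyclic = 0; the first makes Q of codimension two in v and
   contained in ker Psi, so that L = Q^perp has dimension two.  The heart is
   that L is totally isotropic.  Otherwise pick u in L with <u,u> <> 0 and let
   al in L be dual to omega(u, .).
   - If <al,al> <> 0, then L is nondegenerate, each A in h acts on it without
     trace and so kills F = [u, al]; the geodesic orbit condition at F + T
     yields [T, F] = 0, whence Psi T = 0.
   - If <al,al> = 0, the condition at e_m + u forces Psi u = 0, and then h kills
     e_m.  With omega(u,b) = 1, F = [u,b] and X = e_1 - <F,e_1> e_m, orthogonal
     to F, the condition at X + b gives A with A X = - Psi b and A u = 0;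
     comparing A F and A X on Psi b yields |Psi b|^2 = 0, whence Psi = 0.
   The remaining claims follow since a subspace of v on which the form is
   nonpositive has dimension at most ind v. *)

Set Implicit Arguments.
Unset Strict Implicit.
Unset Printing Implicit Defensive.

Import Order.TTheory GRing.Theory Num.Theory.
Local Open Scope ring_scope.

(** * Symmetric forms and Lorentzian subspaces *)

Section FormTheory.
Variables (R : realType) (n : vectType R) (B : {symmetric n}).
Implicit Types (x y z : n) (U V : {vspace n}) (s : seq n).

Lemma formC x y : B x y = B y x.
Proof. by rewrite hermC expr0 mul1r. Qed.

Lemma formDl x y z : B (x + y) z = B x z + B y z.
Proof. exact: linearDl. Qed.

Lemma formDr x y z : B z (x + y) = B z x + B z y.
Proof. exact: linearDr. Qed.

Lemma formNl x z : B (- x) z = - B x z.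
Proof. exact: linearNl. Qed.

Lemma formNr x z : B z (- x) = - B z x.
Proof. exact: linearNr. Qed.

Lemma formZl (a : R) x z : B (a *: x) z = a * B x z.
Proof. exact: linearZl_LR. Qed.

Lemma formZr (a : R) x z : B z (a *: x) = a * B z x.
Proof. exact: linearZr_LR. Qed.

Lemma form0l z : B 0 z = 0.
Proof. exact: linear0l. Qed.

Lemma form0r z : B z 0 = 0.
Proof. exact: linear0r. Qed.

Definition formE := (formDl, formDr, formNl, formNr, formZl, formZr, form0l,
  form0r).

Lemma nondegenerate_form_eq0 x :
  nondegenerate B -> (forall y, B x y = 0) -> x = 0.
Proof.
move=> /eqP B0 Bx; apply/eqP; rewrite -memv0 -B0.
by apply/mem_orthovP => y _.
Qed.

Lemma nondegenerate_on_eq0 U x :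
  nondegenerate_on B U -> x \in U -> {in U, forall y, B x y = 0} -> x = 0.
Proof.
move=> /eqP BU xU Bx; apply/eqP; rewrite -memv0 -BU memv_cap xU /=.
exact/mem_orthovP.
Qed.

Lemma pairwise_orthogonal_cons x s :
  pairwise_orthogonal B (x :: s) =
    [&& x != 0, all (fun y => B x y == 0) s & pairwise_orthogonal B s].
Proof.
rewrite /pairwise_orthogonal /= in_cons negb_or eq_sym !andbT -!andbA.
by do !bool_congr.
Qed.

Lemma pairwise_orthogonal_neq0 s x :
  pairwise_orthogonal B s -> x \in s -> x != 0.
Proof. by case/andP=> s0 _ xs; apply: contraNneq s0 => <-. Qed.

Lemma pairwise_orthogonal_eq0 s x y :
  pairwise_orthogonal B s -> x \in s -> y \in s -> x != y -> B x y = 0.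
Proof.
elim: s => // z s IHs; rewrite pairwise_orthogonal_cons => /and3P[_ /allP zs
  os].
rewrite !inE => /predU1P[->|xs] /predU1P[->|ys]; rewrite ?eqxx //.
- by move=> _; apply/eqP/zs.
- by move=> _; rewrite formC; apply/eqP/zs.
- exact: IHs.
Qed.

Lemma pairwise_orthogonal_filter (p : pred n) s :
  pairwise_orthogonal B s -> pairwise_orthogonal B (filter p s).
Proof.
elim: s => // x s IHs; rewrite pairwise_orthogonal_cons => /and3P[x0 /allP xs
  /IHs os] /=.
case: (p x) => //; rewrite pairwise_orthogonal_cons x0 os andbT /=.
by apply/allP => y; rewrite mem_filter => /andP[_]; apply: xs.
Qed.

Lemma memv_span_cons x s y :
  y \in <<x :: s>>%VS -> exists (a : R) z, z \in <<s>>%VS /\ y = a *: x + z.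
Proof.
rewrite span_cons => /memv_addP[_ /vlineP[a ->] [z zs ->]].
by exists a, z.
Qed.

Lemma orth_span s x :
  {in s, forall y, B x y = 0} -> {in <<s>>%VS, forall y, B x y = 0}.
Proof.
elim: s => [_ y|z s IHs xs y].
  by rewrite span_nil memv0 => /eqP ->; rewrite formE.
move=> /memv_span_cons[a [t [ts ->]]]; rewrite !formE.
rewrite xs ?mem_head // IHs // => [|r rs]; first by rewrite mulr0 addr0.
by rewrite xs // in_cons rs orbT.
Qed.

(** A null member of [s] would be orthogonal to all of [s] and so lie in the radical of [U]. *)
Lemma pairwise_orthogonal_anisotropic U s :
    nondegenerate_on B U -> <<s>>%VS = U -> pairwise_orthogonal B s ->
  {in s, forall x, B x x != 0}.
Proof.
move=> ndU sU os x xs; apply/eqP => Bxx.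
have /eqP := pairwise_orthogonal_neq0 os xs; apply;
  apply: (nondegenerate_on_eq0 ndU).
  by rewrite -sU memv_span.
rewrite -sU; apply: orth_span => y ys.
by have [<-|/(pairwise_orthogonal_eq0 os xs ys)] := eqVneq x y.
Qed.

Lemma orthogonal_projection s x :
    pairwise_orthogonal B s -> {in s, forall y, B y y != 0} ->
  exists2 y, y \in <<s>>%VS & {in <<s>>%VS, forall z, B (x - y) z = 0}.
Proof.
suff: pairwise_orthogonal B s -> {in s, forall y, B y y != 0} ->
    exists2 y, y \in <<s>>%VS & {in s, forall z, B (x - y) z = 0}.
  by move=> H os ss; have [y ys xy] := H os ss; exists y => //;
    apply: orth_span.
elim: s => [|a s IHs]; first by exists 0; rewrite ?mem0v.
rewrite pairwise_orthogonal_cons => /and3P[_ /allP oas os] as0.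
have [|y ys xy] := IHs os; first by move=> z zs; apply: as0;
  rewrite in_cons zs orbT.
exists (y + (B (x - y) a / B a a) *: a).
  rewrite span_cons addrC memv_add //.
  by rewrite memvZ // memv_line.
move=> z; rewrite in_cons opprD addrA; set c := _ / _.
rewrite (formDl (x - y)) formNl formZl => /predU1P[->|zs].
  by rewrite divfK ?subrr // as0 ?mem_head.
by rewrite xy // (eqP (oas _ zs)) mulr0 subr0.
Qed.

Lemma span_posdef s :
    pairwise_orthogonal B s -> {in s, forall x, 0 < B x x} ->
  {in <<s>>%VS, forall x, x != 0 -> 0 < B x x}.
Proof.
elim: s => [_ _ x|a s IHs].
  by rewrite span_nil memv0 => ->.
rewrite pairwise_orthogonal_cons => /and3P[_ /allP oas os] as0.
have {}IHs : {in <<s>>%VS, forall x, x != 0 -> 0 < B x x}.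
  by apply: IHs => // z zs; apply: as0; rewrite in_cons zs orbT.
move=> _ /memv_span_cons[c [z [zs ->]]] cz0.
have az : B a z = 0 by apply: (@orth_span s) => // y /oas /eqP.
have a0 : 0 < B a a by apply: as0; rewrite mem_head.
have -> : B (c *: a + z) (c *: a + z) = c ^+ 2 * B a a + B z z.
  by rewrite !formE (formC z a) az; ring.
have [z0|/(IHs _ zs) z0] := eqVneq z 0; last first.
  by rewrite ltr_wpDl // mulr_ge0 ?sqr_ge0 // ltW.
rewrite z0 formE addr0 mulr_gt0 // exprn_even_gt0 //=.
by apply: contraNneq cz0 => ->; rewrite z0 scale0r addr0.
Qed.

(** The basis vectors of positive square span a positive definite space of dimension [p], which
    meets [V] only in 0. *)
Lemma dim_nonpos_le U V p q :
    has_signature B U p q -> (V <= U)%VS -> {in V, forall x, B x x <= 0} ->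
  (\dim V + p <= \dim U)%N.
Proof.
move=> [b [/andP[/eqP bU frb] ob <- _]] VU Vneg.
pose P := <<filter (fun x => (0 < B x x)%R) b>>%VS.
have PU : (P <= U)%VS.
  by rewrite -bU; apply: sub_span => x; rewrite mem_filter => /andP[].
have VP0 : (V :&: P = 0)%VS.
  apply/eqP; rewrite -subv0; apply/subvP => x /memv_capP[xV xP].
  rewrite memv0; apply: contraT => x0.
  have := Vneg x xV; rewrite leNgt; move/negP; case; move: x xP x0 {xV}.
  apply: span_posdef; first exact: pairwise_orthogonal_filter.
  by move=> y; rewrite mem_filter => /andP[].
have -> : count (fun x => 0 < B x x) b = \dim P.
  by rewrite (eqP (filter_free _ frb)) size_filter.
by rewrite -dimv_disjoint_sum // dimvS // subv_add VU PU.
Qed.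

Lemma signature_sum U p q :
  nondegenerate_on B U -> has_signature B U p q -> (p + q)%N = \dim U.
Proof.
move=> ndU [b [/andP[/eqP bU frb] ob <- <-]].
have b0 := pairwise_orthogonal_anisotropic ndU bU ob.
rewrite -bU (eqP frb) -(count_predC (fun x => 0 < B x x) b); congr addn.
apply: eq_in_count => x xb /=; rewrite -leNgt le_eqVlt.
by rewrite (negPf (b0 _ xb)).
Qed.

Lemma dim_nonpos_le_index U V q :
    nondegenerate_on B U -> has_index B U q -> (V <= U)%VS ->
    {in V, forall x, B x x <= 0} ->
  (\dim V <= q)%N.
Proof.
move=> ndU [p sgU] VU Vneg.
by have := dim_nonpos_le sgU VU Vneg;
  rewrite -(signature_sum ndU sgU) addnC leq_add2l.
Qed.

Lemma nondegenerate_on_projection U p q x :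
    nondegenerate_on B U -> has_signature B U p q ->
  exists2 y, y \in U & x - y \in orthov B U.
Proof.
move=> ndU [b [/andP[/eqP bU frb] ob _ _]].
have [y] := orthogonal_projection x ob (pairwise_orthogonal_anisotropic ndU bU
  ob).
by rewrite bU => yU xy; exists y => //; apply/mem_orthovP.
Qed.

Lemma posdef_orthonormal_basis U :
    {in U, forall x, x != 0 -> 0 < B x x} ->
  exists w, basis_of U w /\ orthonormal B w.
Proof.
have [m] := ubnP (\dim U); elim: m U => // m IHm U dimU posU.
have [->|U0] := eqVneq U 0%VS; first by exists [::]; rewrite nil_basis.
pose x := vpick U; have xU : x \in U := memv_pick U.
have x0 : x != 0 by rewrite vpick0.
have Bx := posU _ xU x0.
pose e := (Num.sqrt (B x x))^-1 *: x.
have eU : e \in U by rewrite memvZ.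
have Be : B e e = 1.
  rewrite /e !formE mulrA -invfM -expr2 sqr_sqrtr ?ltW // mulVf //.
  by rewrite gt_eqF.
have e0 : e != 0 by apply: contraTneq (oner_neq0 R) => e0;
  rewrite -Be e0 formE eqxx.
pose U' := (U :&: orthov B <[e]>)%VS.
have U'P y : y \in U' -> y \in U /\ B e y = 0.
  by rewrite memv_cap mem_orthov1 formC => /andP[-> /eqP].
have eU' : e \notin U' by apply/negP => /U'P[_]; rewrite Be => /eqP;
  rewrite oner_eq0.
have decU : (<[e]> + U')%VS = U.
  apply/eqP; rewrite eqEsubv subv_add -memvE eU capvSl /=.
  apply/subvP => y yU; rewrite -(subrK (B y e *: e) y) addrC memv_add //.
    by rewrite memvZ // memv_line.
  rewrite memv_cap rpredB //= ?memvZ // mem_orthov1 formDl formNl formZl Be.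
  by rewrite mulr1 subrr.
have [||w [/andP[/eqP wU' frw] ow]] := IHm U'; last exists (e :: w).
- have : (\dim U' < \dim U)%N.
    rewrite ltn_neqAle dimvS ?capvSl // andbT; apply: contra eU' => dimU'.
    by have /eqP -> : U' == U by rewrite eqEdim capvSl (eqP dimU') leqnn.
  by move=> ltU'; apply: leq_trans ltU' _.
- by move=> y /U'P[yU _]; apply: posU.
split; first by rewrite /basis_of span_cons wU' decU eqxx free_cons wU' eU' frw.
move: ow; rewrite /orthonormal /= => /andP[-> ->]; rewrite Be eqxx !andbT /=.
by apply/allP => y yw /=; have /U'P[_ ->] : y \in U' by rewrite -wU' memv_span.
Qed.

Lemma lorentzian_null_vector U :
  lorentzian B U -> exists2 x, x \in U & x != 0 /\ B x x = 0.
Proof.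
case=> dimU [b [/andP[/eqP bU frb] ob npos nneg]].
have /hasP[y yb By] : has (fun x => 0 < B x x) b.
  by rewrite has_count npos; case: (\dim U) dimU => [|[]].
have /hasP[x xb Bx] : has (fun x => B x x < 0) b by rewrite has_count nneg.
have xy : x != y by apply: contraTneq By => <-; rewrite -leNgt ltW.
have Bxy := pairwise_orthogonal_eq0 ob xb yb xy.
(* The weights make the contributions of [x] and [y] to the square cancel. *)
exists (Num.sqrt (B y y) *: x + Num.sqrt (- B x x) *: y).
  by rewrite rpredD // memvZ // -bU memv_span.
have sqy := sqr_sqrtr (ltW By).
have sqx : Num.sqrt (- B x x) ^+ 2 = - B x x
  by rewrite sqr_sqrtr // oppr_ge0 ltW.
split; last by rewrite !formE (formC y x) Bxy; ring: sqx sqy.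
apply/eqP => /(congr1 (B y)); rewrite !formE (formC y x) Bxy mulr0 add0r.
by apply/eqP; rewrite mulf_neq0 ?gt_eqF // sqrtr_gt0 oppr_gt0.
Qed.

(** Otherwise [x] and [e] would span a plane on which the form is nonpositive; with [\dim U - 1]
    positive squares only a line is possible. *)
Lemma lorentzian_orth_null U e x :
    lorentzian B U -> e \in U -> e != 0 -> B e e = 0 ->
    x \in U -> B e x = 0 -> B x x <= 0 -> x \in <[e]>%VS.
Proof.
move=> [dimU sgU] eU e0 Be xU Bex Bx; apply: contraT => xe.
have VU : (<[x]> + <[e]> <= U)%VS by rewrite subv_add -!memvE xU.
have/(dim_nonpos_le sgU VU) : {in (<[x]> + <[e]>)%VS, forall y, B y y <= 0}.
  move=> _ /memv_addP[_ /vlineP[a ->] [_ /vlineP[c ->] ->]].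
  rewrite !formE Be (formC x e) Bex !mulr0 !addr0 mulrA -expr2.
  by rewrite mulr_ge0_le0 // sqr_ge0.
rewrite dimv_disjoint_sum; last first.
  apply/eqP; rewrite -subv0; apply/subvP => y /memv_capP[/vlineP[a ->]].
  have [->|a0] := eqVneq a 0; first by rewrite scale0r !mem0v.
  by move=> /(memvZ a^-1); rewrite scalerA mulVf // scale1r (negPf xe).
have x0 : x != 0 by apply: contraNneq xe => ->; rewrite mem0v.
rewrite !dim_vline x0 e0; case: (\dim U) dimU => // d _.
by rewrite addSn /= ltnn.
Qed.

Lemma lorentzian_witt_basis U em :
    nondegenerate_on B U -> lorentzian B U -> em \in U -> em != 0 -> B em em =
      0 ->
  exists e1 w, witt_basis B U e1 w em.
Proof.
move=> ndU lorU emU em0 Bem.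
have [y yU Bemy] : exists2 y, y \in U & B em y = 1.
  have [y yU Bemy] : exists2 y, y \in U & B em y != 0.
    apply/mem_orthovPn; apply: contra em0 => /mem_orthovP emo.
    exact/eqP/(nondegenerate_on_eq0 ndU emU).
  by exists ((B em y)^-1 *: y); rewrite ?memvZ // formZr mulVf.
(* This multiple of [em] makes [e1] null and leaves its product with [em] equal to 1. *)
pose e1 := y - (B y y / 2) *: em.
have e1U : e1 \in U by rewrite rpredB // !memvZ.
have Be1m : B e1 em = 1 by rewrite /e1 formDl formNl formZl (formC y) Bemy Bem
  mulr0 subr0.
have Be1 : B e1 e1 = 0.
  rewrite {2}/e1 formDr formNr formZr Be1m /e1 formDl formNl formZl Bemy.
  by field.
clearbody e1; pose W := (U :&: (orthov B <[em]> :&: orthov B <[e1]>))%VS.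
have WP x : x \in W -> [/\ x \in U, B em x = 0 & B e1 x = 0].
  by rewrite !memv_cap !mem_orthov1 !(formC x) => /and3P[-> /eqP-> /eqP->].
(* [W] is positive definite: a vector of nonpositive square in it is a multiple of [em], and being
   orthogonal to [e1] it is 0. *)
have [|w [/andP[/eqP wW frw] ow]] := @posdef_orthonormal_basis W.
  move=> x /WP[xU Bmx B1x] x0; rewrite ltNge; apply: contra x0.
  move=> /(lorentzian_orth_null lorU emU em0 Bem xU Bmx)/vlineP[a xa].
  by move: B1x; rewrite xa formZr Be1m mulr1 => ->; rewrite scale0r.
exists e1, w.
have memW z : z \in <<w>>%VS -> B em z = 0 /\ B e1 z = 0 by rewrite wW => /WP[].
split=> //; last by move=> z zw; have [-> ->] := memW z (memv_span zw).
have eqs : <<e1 :: rcons w em>>%VS = (<[e1]> + (<[em]> + <<w>>))%VS.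
  by rewrite span_cons -cats1 span_cat span_seq1 (addvC <<w>>%VS).
rewrite /basis_of; apply/andP; split.
  rewrite eqs eqEsubv !subv_add -!memvE e1U emU wW capvSl /=.
  apply/subvP => x xU.
  rewrite -(subrK (B x em *: e1 + B x e1 *: em) x) addrC -addrA.
  rewrite memv_add ?memvZ ?memv_line // memv_add ?memvZ ?memv_line //.
  rewrite !memv_cap !mem_orthov1 !formE Be1 Bem Be1m (formC em e1) Be1m.
  rewrite rpredB ?rpredD ?memvZ //=.
  by apply/andP; split; apply/eqP; ring.
have /perm_free frE : perm_eq (rcons w em) (em :: w) by rewrite perm_rcons.
rewrite free_cons frE free_cons frw andbT; apply/andP; split.
  rewrite -cats1 span_cat span_seq1;
    apply/negP => /memv_addP[z zw [_ /vlineP[a ->] e1E]].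
  have := Be1m; rewrite e1E formDl formZl Bem mulr0 addr0 formC.
  by have [-> _] := memW z zw; move/eqP; rewrite eq_sym oner_eq0.
by apply/negP => /memW[_]; rewrite Be1m => /eqP; rewrite oner_eq0.
Qed.

(** * Coordinates with respect to a Witt basis *)

Section WittBasis.
Variables (U : {vspace n}) (e1 : n) (w : seq n) (em : n).
Hypothesis wb : witt_basis B U e1 w em.

Lemma witt_form : [/\ B e1 em = 1, B em e1 = 1, B e1 e1 = 0 & B em em = 0].
Proof. by case: wb => _ [Be1m Be1 Bem] _ _; rewrite (formC em). Qed.

Lemma witt_mem : [/\ e1 \in U, em \in U & (<<w>> <= U)%VS].
Proof.
case: wb => /span_basis <- _ _ _; split.
- by rewrite memv_span // mem_head.
- by rewrite memv_span // in_cons mem_rcons mem_head orbT.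
by apply: sub_span => z zw; rewrite in_cons mem_rcons in_cons zw !orbT.
Qed.

Lemma witt_orth : {in <<w>>%VS, forall z, B e1 z = 0 /\ B em z = 0}.
Proof.
case: wb => _ _ we _ z zw.
by split; move: z zw; apply: orth_span => z /we[].
Qed.

Lemma witt_decomposition x :
  x \in U -> exists2 z, z \in <<w>>%VS & x = B x em *: e1 + z + B x e1 *: em.
Proof.
have [Be1m Beme1 Be1 Bem] := witt_form.
case: wb => /span_basis <- _ _ _ /memv_span_cons[a [y [yw ->]]].
move: yw; rewrite -cats1 span_cat span_seq1 => /memv_addP[z zw [_ /vlineP[c ->]
  ->]].
have [ze1 zem] := witt_orth zw.
exists z => //; rewrite !formE Be1m Beme1 Be1 Bem !(formC z) ze1 zem.
by rewrite !mulr0 !mulr1 !add0r !addr0 addrA.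
Qed.

Lemma witt_posdef : {in <<w>>%VS, forall z, z != 0 -> 0 < B z z}.
Proof.
case: wb => _ _ _; rewrite orthonormalE => /andP[/allP w1 ow].
by apply: span_posdef => // z /w1 /eqP ->.
Qed.

End WittBasis.

End FormTheory.

(** * Nilpotent Lie algebras *)

Section LieTheory.
Variables (R : realType) (n : lieAlgType R).
Implicit Types (x y z T : n) (U W : {vspace n}).

Lemma lieDl x y z : lie (x + y) z = lie x z + lie y z.
Proof. exact: linearDl. Qed.

Lemma lieDr x y z : lie z (x + y) = lie z x + lie z y.
Proof. exact: linearDr. Qed.

Lemma lieNl x z : lie (- x) z = - lie x z.
Proof. exact: linearNl. Qed.

Lemma lieNr x z : lie z (- x) = - lie z x.
Proof. exact: linearNr. Qed.

Lemma lieZl (a : R) x z : lie (a *: x) z = a *: lie x z.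
Proof. exact: linearZl_LR. Qed.

Lemma lieZr (a : R) x z : lie z (a *: x) = a *: lie z x.
Proof. exact: linearZr_LR. Qed.

Lemma lie0l z : lie 0 z = 0.
Proof. exact: linear0l. Qed.

Lemma lie0r z : lie z 0 = 0.
Proof. exact: linear0r. Qed.

Definition lieE :=
  (lieDl, lieDr, lieNl, lieNr, lieZl, lieZr, lie0l, lie0r, @lie_alternating R
    n).

Lemma lie_jacobiE x y z : lie (lie x y) z = lie x (lie y z) - lie y (lie x z).
Proof.
apply/esym/eqP; rewrite -subr_eq0 (lieC (lie x y) z) (lieC x z) lieNr !opprK.
by rewrite lie_jacobi.
Qed.

Lemma liev_ind U W (P : n -> Prop) :
    P 0 -> (forall (a : R) x y, P x -> P y -> P (a *: x + y)) ->
    {in U & W, forall x y, P (lie x y)} ->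
  {in liev U W, forall z, P z}.
Proof.
move=> P0 PD Plie z zUW.
pose X := in_tuple [seq lie x y | x <- vbasis U, y <- vbasis W].
rewrite (coord_span (zUW : z \in <<X>>%VS));
  elim/big_ind: _ => // [x y Px Py|i _].
  by rewrite -[x]scale1r; apply: PD.
rewrite -[_ *: _]addr0; apply: PD => //.
have /allpairsP[[x y] /= [xU yW ->]] : X`_i \in tval X by rewrite mem_nth.
by apply: Plie; apply: vbasis_mem.
Qed.

Lemma lower_central_lie i x y :
  y \in lower_central n i -> lie x y \in lower_central n i.+1.
Proof. by move=> yi; rewrite memv_liev ?memvf. Qed.

Lemma lower_central_iter i x y : iter i (lie x) y \in lower_central n i.
Proof. by elim: i => [|i IHi]; [exact: memvf | exact: lower_central_lie]. Qed.

Lemma lower_central_sub i : (lower_central n i.+1 <= lower_central n i)%VS.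
Proof.
elim: i => [|i IHi]; first exact: subvf.
apply/lievP => x y _ yi; apply: lower_central_lie.
exact: (subvP IHi).
Qed.

Lemma lower_central_le i j :
  (i <= j)%N -> (lower_central n j <= lower_central n i)%VS.
Proof.
move=> /subnK <-; elim: (j - i)%N => [|m IHm]; first exact: subvv.
exact: subv_trans (lower_central_sub _) IHm.
Qed.

Lemma lie_derived x y : lie x y \in derived n.
Proof. by rewrite memv_liev ?memvf. Qed.

(* A nilpotent Lie algebra is generated by any subspace that spans it modulo its
   derived algebra. *)
Lemma nilpotent_generated_ind (V : {vspace n}) (P : n -> Prop) :
    nilpotent_lie n ->
    (forall x, exists2 y, y \in V & x - y \in derived n) ->
    {in V, forall x, P x} ->
    (forall (a : R) x y, P x -> P y -> P (a *: x + y)) ->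
    (forall x y, P x -> P y -> P (lie x y)) ->
  forall x, P x.
Proof.
move=> [m /eqP Cm] genV PV PD Plie.
have P0 : P 0 by apply: PV; apply: mem0v.
have PA x y : P x -> P y -> P (x + y) by rewrite -{2}[x]scale1r; apply: PD.
(* Successive approximation: [x] satisfies [P] up to ever deeper terms of the lower central series,
   which finally vanish. *)
have approx i : forall x, exists2 s, P s & x - s \in lower_central n i.+1.
  elim: i => [x|i IHi x].
    by have [y yV xy] := genV x; exists y => //; apply: PV.
  have [y yV xy] := genV x.
  suff [s Ps xs] : exists2 s, P s & x - y - s \in lower_central n i.+2.
    by exists (y + s); [apply: PA => //; apply: PV | rewrite opprD addrA].
  move: (x - y) xy => z zd {x y yV}.
  apply: (liev_ind (P := fun z => exists2 s, P s & z - s \in lower_central n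
    i.+2) _ _ _ zd) => {z zd}.
  - by exists 0; rewrite // subr0 mem0v.
  - move=> a x y [s Ps xs] [t Pt yt]; exists (a *: s + t); first exact: PD.
    by rewrite opprD addrACA -scalerBr rpredD // memvZ.
  move=> x y _ _; have [s Ps xs] := IHi x; have [t Pt yt] := IHi y.
  exists (lie s t); first exact: Plie.
  (* Both errors stand in the second slot of a bracket, so each gains one step in the series. *)
  have -> : lie x y - lie s t = lie x (y - t) - lie t (x - s).
    by rewrite !lieE (lieC t x) (lieC t s) opprB !opprK (addrC _ (lie x t))
      addrA subrK.
  by rewrite rpredB // lower_central_lie.
move=> x; have [s Ps] := approx m x.
move=> /(subvP (lower_central_sub m)); rewrite Cm memv0 subr_eq0 => /eqP -> //.
Qed.

End LieTheory.

(** * Geodesic orbit metrics with Lorentzian derived algebra *)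

Section GeodesicOrbitTheory.
Variables (R : realType) (n : lieAlgType R) (B : {symmetric n}).
Variables (h : {vspace 'End(n)}).
Hypotheses (n_nilpotent : nilpotent_lie n)
           (B_nondegenerate : nondegenerate B)
           (h_derivation : {in h, forall A, derivation A})
           (h_skew : {in h, forall A, skew_adjoint B A})
           (GO : geodesic_orbit B h)
           (d_nondegenerate : nondegenerate_on B (derived n))
           (d_lorentzian : lorentzian B (derived n)).
Local Notation d := (derived n).
Local Notation v := (orth_derived B).

Lemma orth_derivedP x : reflect {in d, forall y, B x y = 0} (x \in v).
Proof. exact: mem_orthovP. Qed.

Lemma derived_projection x : exists2 y, y \in v & x - y \in d.
Proof.
have [y yd xy] := nondegenerate_on_projection x d_nondegenerate (proj2
  d_lorentzian).
by exists (x - y) => //; rewrite opprB addrC subrK.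
Qed.

(** A vector of v orthogonal to v is orthogonal to v + d, which is all of n. *)
Lemma orth_derived_nondegenerate : nondegenerate_on B v.
Proof.
rewrite /nondegenerate_on -subv0; apply/subvP => x; rewrite memv_cap memv0.
move=> /andP[/orth_derivedP xd /mem_orthovP xv].
apply/eqP; apply: (nondegenerate_form_eq0 B_nondegenerate) => y.
have [z zv yz] := derived_projection y.
by rewrite -(subrK z y) formDr xd // xv // addr0.
Qed.

Lemma derivation_derived A x : A \in h -> x \in d -> A x \in d.
Proof.
move=> Ah; move: x; apply: liev_ind; first by rewrite linear0 mem0v.
  by move=> a x y xd yd; rewrite linearP rpredD // memvZ.
by move=> x y _ _; rewrite h_derivation // rpredD ?lie_derived.
Qed.

Lemma derivation_orth_derived A x : A \in h -> x \in v -> A x \in v.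
Proof.
move=> Ah /orth_derivedP xd; apply/orth_derivedP => y yd.
by rewrite h_skew // xd ?oppr0 // derivation_derived.
Qed.

Lemma skew_form_eq0 A x : A \in h -> B (A x) x = 0.
Proof. by move=> Ah; have := h_skew Ah x x; rewrite formC; lra. Qed.

(** * Skewness of ad(n) on d and its normal form *)

Lemma geodesic_form_eq0 Y X : Y \in v -> X \in d -> B (lie Y X) X = 0.
Proof.
(* The geodesic orbit condition at [W + Z], tested against [W] and against [Z]; the scalar may
   depend on the vector. *)
have key Z W : Z \in v -> W \in d ->
    exists k, B (lie Z W) W = k * B W W /\ - B (lie Z W) W = k * B Z Z.
  move=> Zv Wd; have [A Ah [k kP]] := GO (W + Z); exists k.
  have ZW : B Z W = 0 by apply: (orth_derivedP _ Zv).
  have ZA : B Z (A W) = 0 by apply: (orth_derivedP _ Zv);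
    apply: derivation_derived.
  have Zl x y : B (lie x y) Z = 0 by rewrite formC;
    apply: (orth_derivedP _ Zv); apply: lie_derived.
  have := kP W; have := kP Z; rewrite !lieE !formE (lieC W Z) !formE.
  rewrite !skew_form_eq0 // (h_skew Ah Z W) ZA !Zl !(formC B W Z) (formC B (A
    W) Z) ZA ZW.
  by rewrite !addr0 !add0r !oppr0 !addr0 => -> ->.
move=> Yv Xd; have [k [kX kY]] := key Y X Yv Xd.
(* Doubling [X] gives [c = l * a] and [- 4 c = l * b]. If [c] is nonzero, the first forces [l = k],
   and the second then contradicts [- c = k * b]. *)
have [l [lX lY]] := key Y (2 *: X) Yv (memvZ _ Xd).
move: lX lY; rewrite !lieE !formE => lX lY.
set c := B (lie Y X) X in kX kY lX lY *; set a := B X X in kX lX.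
set b := B Y Y in kY lY.
have la : c = l * a by lra.
apply/eqP; apply: contraT => c0.
have a0 : a != 0 by apply: contraNneq c0 => a0; rewrite kX a0 mulr0.
have kl : k = l by apply: (mulIf a0); rewrite -kX.
rewrite -kl -kY in lY; have c1 : c = 0 by lra.
by rewrite c1 eqxx in c0.
Qed.

(** For [T] in v this is polarization; skewness on d passes to linear combinations and commutators,
    and v generates n. *)
Lemma ad_skew T X Y : X \in d -> Y \in d -> B (lie T X) Y = - B X (lie T Y).
Proof.
move: X Y; pose P T := {in d &, forall X Y, B (lie T X) Y = - B X (lie T Y)}.
suff: P T by [].
apply: (nilpotent_generated_ind (P := P) n_nilpotent derived_projection) => {T}.
- move=> T Tv X Y Xd Yd; have := geodesic_form_eq0 Tv (memvD Xd Yd).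
  rewrite !lieE !formE !geodesic_form_eq0 // (formC B X) => H; lra.
- move=> a T S PT PS X Y Xd Yd; rewrite !lieE !formE PT // PS //; ring.
move=> T S PT PS X Y Xd Yd; rewrite !lie_jacobiE !formE.
rewrite (PT _ _ (lie_derived S X) Yd) (PS _ _ Xd (lie_derived T Y)).
by rewrite (PS _ _ (lie_derived T X) Yd) (PT _ _ Xd (lie_derived S Y)); ring.
Qed.

Lemma ad_null T X : X \in d -> B (lie T X) X = 0.
Proof. by move=> Xd; have := ad_skew T Xd Xd; rewrite formC; lra. Qed.

Lemma central_null_vector :
  exists2 e, e \in d & [/\ e != 0, B e e = 0 & forall T, lie T e = 0].
Proof.
have [/eqP C2|C2] := boolP (nilpotent_step n 2).
  have [e ed [e0 ee]] := lorentzian_null_vector d_lorentzian.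
  exists e => //; split=> // T; apply/eqP.
  by rewrite -memv0 -C2 lower_central_lie.
have ex : exists i, nilpotent_step n i by [].
(* Only a nilpotency step of at least 3 survives, so the last nonzero term [lower_central n i.+2]
   lies in [n, d]. *)
case: (ex_minnP ex) => -[|[|[|i]]] /eqP Ci mini.
- by case/negP: C2; rewrite /nilpotent_step -subv0 -Ci subvf.
- by case/negP: C2; rewrite /nilpotent_step -subv0 -Ci lower_central_le.
- by case/negP: C2; apply/eqP.
have C0 : lower_central n i.+2 != 0%VS by apply/negP => /mini; rewrite ltnn.
pose e := vpick (lower_central n i.+2).
have eC : e \in lower_central n i.+2 := memv_pick _.
have ze T : lie T e = 0.
  by apply/eqP; rewrite -memv0 -Ci lower_central_lie.
have ed : e \in d := subvP (@lower_central_le _ n 1 i.+2 isT) e eC.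
exists e => //; split; rewrite ?vpick0 //.
have : e \in lower_central n 2 := subvP (@lower_central_le _ n 2 i.+2 isT) e eC.
(* By skewness the central [e] is orthogonal to [n, d], which contains [e] itself. *)
have : {in lower_central n 2, forall z, B z e = 0}; last exact.
apply: liev_ind => [|a x y xe ye|x y _ yd]; first exact: form0l.
  by rewrite !formE xe ye mulr0 addr0.
by rewrite ad_skew // ze form0r oppr0.
Qed.

Lemma adapted_basis_exists : exists e1 w em Psi, adapted_basis B e1 w em Psi.
Proof.
have [em emd [em0 Bem em_central]] := central_null_vector.
have [e1 [w wb]] := lorentzian_witt_basis d_nondegenerate d_lorentzian emd em0
  Bem.
have [e1d _ wd] := witt_mem wb; have [Be1m Beme1 Be1 _] := witt_form wb.
have ad_line T X : X \in d -> B em X = 0 -> lie T X \in <[em]>%VS.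
  have adT Y : Y \in d -> B em (lie T Y) = 0.
    by move=> Yd; rewrite formC ad_skew // em_central form0r oppr0.
  (* Descent from a vanishing iterate: if [[T, [T, Y]]] is a multiple of [em], then [[T, Y]] is null
     by skewness and orthogonal to [em], hence itself a multiple of [em]. *)
  have key j : forall Y, Y \in d -> B em Y = 0 ->
      iter j.+1 (lie T) Y \in <[em]>%VS -> lie T Y \in <[em]>%VS.
    elim: j => // j IHj Y Yd emY; rewrite iterSr => TY.
    have /vlineP[a TTY] := IHj _ (lie_derived T Y) (adT Y Yd) TY.
    apply: (lorentzian_orth_null d_lorentzian); rewrite ?lie_derived ?adT //.
    by rewrite ad_skew ?lie_derived // TTY formZr formC emY mulr0 oppr0.
  move=> Xd emX; have [m /eqP Cm] := n_nilpotent.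
  apply: (key m) => //; rewrite iterS.
  have := lower_central_iter m T X; rewrite Cm memv0 => /eqP ->.
  by rewrite lie0r mem0v.
(* [Psi T] is [[T, e1]]; by skewness it is orthogonal to [e1] and to [em], so it lies in W_0. *)
exists e1, w, em, (linfun (applyr (@lie R n) e1)); split=> // T.
rewrite lfunE /=; split=> //.
  have [z zw] := witt_decomposition wb (lie_derived T e1).
  rewrite ad_null // ad_skew // em_central form0r oppr0 !scale0r add0r addr0.
  by move=> ->.
move=> z zw; have [ze1 zem] := witt_orth wb zw.
have zd : z \in d by apply: (subvP wd).
have /vlineP[a Tz] := ad_line T z zd zem.
rewrite (formC B (lie T e1));
  rewrite -(ad_skew T zd e1d) Tz formZl Beme1 mulr1 //.
Qed.

(** * Consequences of the normal form: Jacobi identities and geodesic equations *)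

Section AdaptedBasis.
Variables (e1 : n) (w : seq n) (em : n) (Psi : 'End(n)).
Hypothesis ab : adapted_basis B e1 w em Psi.
Local Notation Q := (ker_omega B em).
Local Notation L := (ker_omega_perp B em).
Local Notation o x y := (B (lie x y) em).

Let wb : witt_basis B d e1 w em := proj1 ab.
Let e1d : e1 \in d. Proof. by case: (witt_mem wb). Qed.
Let emd : em \in d. Proof. by case: (witt_mem wb). Qed.
Let Be1m : B e1 em = 1. Proof. by case: (witt_form wb). Qed.
Let Beme1 : B em e1 = 1. Proof. by case: (witt_form wb). Qed.
Let Bem : B em em = 0. Proof. by case: (witt_form wb). Qed.
Let Psi_w T : Psi T \in <<w>>%VS. Proof. by case: (proj2 ab T). Qed.
Let lie_em T : lie T em = 0. Proof. by case: (proj2 ab T). Qed.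

Lemma Psi_derived T : Psi T \in d.
Proof. by have [_ _ /subvP wd] := witt_mem wb; apply: wd. Qed.

Lemma Psi_orth T : B (Psi T) e1 = 0 /\ B (Psi T) em = 0.
Proof. by rewrite !(formC B (Psi T)); apply: (witt_orth wb). Qed.

Lemma Psi_anisotropic T : B (Psi T) (Psi T) = 0 -> Psi T = 0.
Proof.
move=> PT; apply/eqP; apply: contraT => /(witt_posdef wb (Psi_w T)).
by rewrite PT ltxx.
Qed.

(** The clauses of the normal form combined into one coordinate-free formula. *)
Lemma lie_derivedE T x : x \in d -> lie T x = B x em *: Psi T - B (Psi T) x *:
  em.
Proof.
have [_ Te1 Tw _] := proj2 ab T; have [PTe1 PTem] := Psi_orth T.
move=> /(witt_decomposition wb)[z zw xE]; have -> : B (Psi T) x = B (Psi T) z.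
  by rewrite [in LHS]xE !formE PTe1 PTem !mulr0 add0r addr0.
by rewrite [in LHS]xE !lieE Te1 Tw // lie_em scaler0 addr0 scaleNr.
Qed.

(** [Psi x = - [e1, x]], and the normal form of ad [e1] is zero because [Psi e1 = [e1, e1] = 0]. *)
Lemma Psi_derived_eq0 x : x \in d -> Psi x = 0.
Proof.
have lieE1 T : lie T e1 = Psi T by case: (proj2 ab T).
have Pe1 : Psi e1 = 0 by rewrite -lieE1 lie_alternating.
move=> xd; rewrite -lieE1 lieC lie_derivedE // Pe1 form0l scaler0 scale0r.
by rewrite subr0 oppr0.
Qed.

Lemma derived_abelian x y : x \in d -> y \in d -> lie x y = 0.
Proof.
by move=> xd yd; rewrite lie_derivedE // Psi_derived_eq0 // form0l scaler0
  scale0r subr0.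
Qed.

(** [Psi] always kills d; if it also kills v, it is zero and the normal form gives [n, d] = 0. *)
Lemma two_step_or_Psi_neq0 :
  nilpotent_step n 2 \/ exists2 T, T \in v & Psi T != 0.
Proof.
have [vP|/subvPn[T Tv]] := boolP (v <= lker Psi)%VS; last first.
  by rewrite memv_ker; right; exists T.
left; rewrite /nilpotent_step -subv0; apply/lievP => T x _ xd.
have [y yv Ty] := derived_projection T.
have : Psi T = 0.
  rewrite -(subrK y T) linearD /= Psi_derived_eq0 // add0r.
  by apply/eqP; rewrite -memv_ker; apply: (subvP vP).
by rewrite memv0 lie_derivedE // => ->; rewrite form0l scaler0 scale0r subr0.
Qed.

Lemma omegaC x y : o x y = - o y x.
Proof. by rewrite lieC formNl. Qed.

Lemma omega_diag x : o x x = 0.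
Proof. by rewrite lie_alternating form0l. Qed.

Lemma omega_derived x y : y \in d -> o x y = 0.
Proof. by move=> yd; rewrite ad_skew // lie_em form0r oppr0. Qed.

(** The Jacobi identity expanded by [lie_derivedE] reads [S = s *: em] with [S] in W_0, so its
    W_0-part and its [em]-part vanish separately. *)
Lemma jacobi_omega_Psi x y z :
  o y z *: Psi x + o z x *: Psi y + o x y *: Psi z = 0 /\
  B (Psi x) (lie y z) + B (Psi y) (lie z x) + B (Psi z) (lie x y) = 0.
Proof.
have := lie_jacobi x y z.
rewrite !(lie_derivedE _ (lie_derived _ _)).
pose S := o y z *: Psi x + o z x *: Psi y + o x y *: Psi z.
pose s := B (Psi x) (lie y z) + B (Psi y) (lie z x) + B (Psi z) (lie x y) => Ss.
have SE : S = s *: em.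
  apply/eqP; rewrite -subr_eq0 -[X in _ == X]Ss /S /s !scalerDl !opprD addrACA.
  by rewrite (addrACA (_ *: _)).
have s0 : s = 0.
  have := congr1 (B^~ e1) SE; rewrite /S !formE Beme1.
  by rewrite (Psi_orth x).1 (Psi_orth y).1 (Psi_orth z).1 !mulr0 !addr0 mulr1.
by split; rewrite // -/S SE s0 scale0r.
Qed.

(** The condition at [X + Y]: testing against d determines [A X], since d is abelian and
    nondegenerate, and testing against v gives the second equation. *)
Lemma geodesic_equations X Y : X \in d -> Y \in v ->
  exists2 A, A \in h & exists k : R, A X = - lie Y X - k *: X /\
    {in v, forall z, B (A Y) z = B (lie Y z) X - k * B Y z}.
Proof.
move=> Xd Yv; have [A Ah [k kP]] := GO (X + Y); exists A => //; exists k.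
have Yd z : z \in d -> B z Y = 0 by rewrite formC; apply: (orth_derivedP _ Yv).
have AX := derivation_derived Ah Xd.
split.
  apply/eqP; rewrite -subr_eq0; apply/eqP.
  apply: (nondegenerate_on_eq0 d_nondegenerate).
    by rewrite !(rpredB, rpredN) ?lie_derived ?memvZ // .
  move=> z zd; have := kP z;
    rewrite lieDl (derived_abelian Xd zd) add0r !formDr !formDl.
  rewrite (Yd _ (lie_derived Y z)) (Yd _ (derivation_derived Ah zd)).
  rewrite (formC B Y) (Yd _ zd) (formC B (A z)) -[B X (A z)]opprK -(h_skew Ah).
  rewrite (ad_skew _ zd Xd) !formE (formC B z); lra.
move=> z zv; have := kP z; rewrite lieDl !formDr !formDl.
rewrite (Yd _ (lie_derived Y z)) (Yd _ (lie_derived X z)).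
have -> : B (lie X z) X = 0 by rewrite lieC formNl (ad_null _ Xd) oppr0.
have -> : B X z = 0 by rewrite formC; apply: (orth_derivedP _ zv).
have -> : B (A z) X = 0 by apply: (orth_derivedP _ (derivation_orth_derived Ah
  zv)).
rewrite (h_skew Ah z) (formC B z) => H; lra.
Qed.

(** The representing vector is read off from the geodesic equations at [em + u]. *)
Lemma omega_dual u :
  u \in v -> exists2 j, j \in v & {in v, forall z, B j z = o u z}.
Proof.
move=> uv; have [A Ah [k [_ AE]]] := geodesic_equations emd uv.
exists (A u + k *: u); first
  by rewrite rpredD ?memvZ // derivation_orth_derived.
by move=> z zv; rewrite formDl formZl AE // subrK.
Qed.

Lemma ker_omegaP x : reflect (x \in v /\ {in v, forall y, o x y = 0}) (x \in Q).
Proof.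
rewrite memv_cap; apply: (iffP andP) => -[xv xo]; split=> //.
  by move/mem_orthovP: xo => xo y yv; apply: xo.
by apply/mem_orthovP => y yv; apply: xo.
Qed.

Lemma omega_neq0 x : x \in v -> x \notin Q -> exists2 y, y \in v & o x y = 1.
Proof.
move=> xv; rewrite memv_cap xv /= => /mem_orthovPn[y yv oxy].
by exists ((o x y)^-1 *: y); rewrite ?memvZ // lieZr formZl mulVf.
Qed.

Lemma omega_projection x y z : z \in v -> x - z \in d -> o x y = o z y.
Proof.
move=> zv xz; rewrite -[x in LHS](subrK z) lieDl formDl (omegaC (x - z)).
by rewrite (omega_derived _ xz) oppr0 add0r.
Qed.

(** If omega vanished on v, every bracket would be orthogonal to [em], contradicting [B e1 em = 1]
    with [e1] in d. *)
Lemma omega_witness : exists a b, [/\ a \in v, b \in v & o a b = 1].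
Proof.
have [/subvP vQ|/subvPn[a av aQ]] := boolP (v <= Q)%VS; last first.
  by have [b bv oab] := omega_neq0 av aQ; exists a, b.
suff /(_ _ e1d)/eqP : {in d, forall z, B z em = 0} by rewrite Be1m oner_eq0.
apply: liev_ind => [|a x y xe ye|x y _ _]; first exact: form0l.
  by rewrite !formE xe ye mulr0 addr0.
have [x' xv xx] := derived_projection x;
  have [y' yv yy] := derived_projection y.
rewrite (omega_projection _ xv xx) omegaC (omega_projection _ yv yy) omegaC
  opprK.
by have /ker_omegaP[_ ->] := vQ _ xv.
Qed.

(** * [Q] and [L] described by a pair with omega(a, b) = 1 *)

Section OmegaPair.
Variables a b : n.
Hypotheses (av : a \in v) (bv : b \in v) (oab : o a b = 1).

(** The first Jacobi identity for [Y], [a], [b], solved for [Psi Y]; in particular [Psi] has rank at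
    most two. *)
Lemma Psi_omega_pair Y : Psi Y = o Y b *: Psi a + o a Y *: Psi b.
Proof.
have [+ _] := jacobi_omega_Psi Y a b.
rewrite oab scale1r (omegaC b Y) (omegaC Y a) !scaleNr -addrA -opprD => /eqP.
by rewrite subr_eq0 => /eqP.
Qed.

(** This gives [Q] codimension two in v. Here [Psi Y = 0], so the Jacobi identity for [c], [Y], [Z]
    leaves [o Y Z *: Psi c = 0] for [c] equal to [a] or [b], and [Psi a], [Psi b] cannot both
    vanish. *)
Lemma mem_ker_omega_pair T Y :
  Psi T != 0 -> Y \in v -> o a Y = 0 -> o b Y = 0 -> Y \in Q.
Proof.
move=> PT Yv oaY obY; apply/ker_omegaP; split=> // Z Zv.
have PY : Psi Y = 0 by rewrite Psi_omega_pair oaY (omegaC Y) obY oppr0 !scale0r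
  addr0.
have kill c : o c Y = 0 -> o Y Z *: Psi c = 0.
  move=> ocY; have [+ _] := jacobi_omega_Psi c Y Z.
  by rewrite PY ocY scaler0 scale0r !addr0.
apply/eqP; apply: contraT => oYZ; move: PT.
move: (kill a oaY) (kill b obY) => /eqP + /eqP.
rewrite !scaler_eq0 (negPf oYZ) /= => /eqP Pa /eqP Pb.
by rewrite Psi_omega_pair Pa Pb !scaler0 addr0 eqxx.
Qed.

Lemma ker_omega_Psi Y : Y \in Q -> Psi Y = 0.
Proof.
move=> /ker_omegaP[Yv YQ].
by rewrite Psi_omega_pair (omegaC a) !YQ // oppr0 !scale0r addr0.
Qed.

Lemma ker_omega_perp_pair T x al be :
    Psi T != 0 -> al \in v -> be \in v ->
    {in v, forall z, B al z = o a z} -> {in v, forall z, B be z = o b z} ->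
  x \in L -> x = B x b *: al - B x a *: be.
Proof.
move=> PT alv bev alE beE; rewrite memv_cap => /andP[xv /mem_orthovP xQ].
apply/eqP; rewrite -subr_eq0; apply/eqP.
apply: (nondegenerate_on_eq0 orth_derived_nondegenerate).
  by rewrite !(rpredB, rpredD) ?memvZ.
(* [y0] is the projection of [y] to [Q] along the span of [a] and [b], so it suffices to compare
   products with [Q], [a] and [b]. *)
move=> y yv; pose y0 := y - (o y b *: a + o a y *: b).
have y0Q : y0 \in Q.
  apply: (mem_ker_omega_pair PT).
  - by rewrite !(rpredB, rpredD) ?memvZ.
  - by rewrite /y0 !lieE !formE oab; ring.
  - by rewrite /y0 !lieE !formE (omegaC b a) oab (omegaC b y); ring.
have xy0 := xQ _ y0Q; move/ker_omegaP: y0Q => [y0v y0Q].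
have yE : y = y0 + (o y b *: a + o a y *: b) by rewrite /y0 subrK.
clearbody y0; move: (o y b) (o a y) yE => s t ->.
rewrite !formE !alE // !beE // !omega_diag oab (omegaC b a) oab.
by rewrite (omegaC a) (omegaC b) !y0Q // xy0; ring.
Qed.

Lemma mem_ker_omega_perp al :
  al \in v -> {in v, forall z, B al z = o a z} -> al \in L.
Proof.
move=> alv alE; rewrite memv_cap alv; apply/mem_orthovP => y /ker_omegaP[yv yQ].
by rewrite alE // omegaC yQ // oppr0.
Qed.

End OmegaPair.

(** * Invariance of [em], [Q] and [L] under h *)

Lemma derivation_em T A : Psi T != 0 -> A \in h -> exists l : R, A em = l *: em.
Proof.
move=> PT Ah; set c := B (Psi T) (Psi T).
have c0 : c != 0 by apply: contra_neq PT; apply: Psi_anisotropic.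
have lem S x : x \in d -> B x em = 0 -> lie S x = - B (Psi S) x *: em.
  by move=> xd xem; rewrite lie_derivedE // xem scale0r sub0r scaleNr.
have Te1 : lie T e1 = Psi T by case: (proj2 ab T).
(* A nonzero multiple of [em] is a double bracket; each of the three terms that [A] produces from it
   brackets a vector of d orthogonal to [em], hence is again a multiple of [em]. *)
have emE : - c *: em = lie T (lie T e1).
  by rewrite Te1 lem ?Psi_derived // (Psi_orth T).2.
have A_emE : exists l : R, A (- c *: em) = l *: em.
  rewrite emE !(h_derivation Ah) Te1 lieDr.
  rewrite lem ?Psi_derived ?(Psi_orth T).2 //.
  rewrite (lem T (lie (A T) e1)) ?lie_derived //; last first.
    by rewrite ad_skew // lie_em form0r oppr0.
  rewrite (lem T (lie T (A e1))) ?lie_derived //; last first.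
    by rewrite omega_derived // derivation_derived.
  by rewrite -!scalerDl; eexists.
have [l lE] := A_emE; exists (- l / c).
have -> : A em = (- c)^-1 *: A (- c *: em).
  by rewrite linearZ /= scalerA mulVf ?scale1r // oppr_eq0.
by rewrite lE scalerA invrN mulNr mulrC mulNr.
Qed.

(** A skew derivation changes omega only through [A em], hence by a scalar; this makes [Q] and [L]
    invariant. *)
Lemma derivation_omega A l x y :
  A \in h -> A em = l *: em -> o (A x) y + o x (A y) = - l * o x y.
Proof.
by move=> Ah Aem; rewrite -formDl -(h_derivation Ah) (h_skew Ah) Aem formZr
  mulNr.
Qed.

Lemma derivation_ker_omega T A x :
  Psi T != 0 -> A \in h -> x \in Q -> A x \in Q.
Proof.
move=> PT Ah /ker_omegaP[xv xQ]; have [l Aem] := derivation_em PT Ah.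
apply/ker_omegaP; split=> [|y yv]; first exact: derivation_orth_derived.
have := derivation_omega x y Ah Aem.
by rewrite !xQ ?derivation_orth_derived // mulr0 addr0.
Qed.

Lemma derivation_ker_omega_perp T A x :
  Psi T != 0 -> A \in h -> x \in L -> A x \in L.
Proof.
move=> PT Ah; rewrite !memv_cap => /andP[xv /mem_orthovP xQ].
rewrite derivation_orth_derived //; apply/mem_orthovP => y yQ.
by rewrite (h_skew Ah) xQ ?oppr0 // (derivation_ker_omega PT).
Qed.

(** [A] applied to [[Y, e1]], with [[Y, A e1]] expanded using [B (A e1) em = - l]. *)
Lemma derivation_Psi A l Y :
    A \in h -> A em = l *: em ->
  A (Psi Y) = Psi (A Y) - l *: Psi Y - B (Psi Y) (A e1) *: em.
Proof.
move=> Ah Aem; have lieE1 S : lie S e1 = Psi S by case: (proj2 ab S).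
rewrite -{1}lieE1 (h_derivation Ah) lieE1 lie_derivedE ?derivation_derived //.
by rewrite (h_skew Ah) Aem formZr Be1m mulr1 addrA scaleNr.
Qed.

Lemma derivation_Psi_form A l Y Z :
    A \in h -> A em = l *: em ->
  B (A (Psi Y)) (Psi Z) = B (Psi (A Y)) (Psi Z) - l * B (Psi Y) (Psi Z).
Proof.
move=> Ah Aem; rewrite (derivation_Psi _ Ah Aem) !formE (formC B em).
by rewrite (Psi_orth Z).2 mulr0 subr0.
Qed.

(** * No vector [u] of [L] has nonzero square *)

Section AnisotropicVector.
Variables T u b al : n.
Hypotheses (Tv : T \in v) (PT : Psi T != 0).
Hypotheses (uL : u \in L) (uu : B u u != 0).
Hypotheses (bv : b \in v) (oub : o u b = 1) (ub : B u b = 0).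
Hypotheses (alv : al \in v) (alE : {in v, forall z, B al z = o u z}).

Let uv : u \in v. Proof. by move: uL; rewrite memv_cap => /andP[]. Qed.
Let alL : al \in L. Proof. exact: (mem_ker_omega_perp uv alv alE). Qed.
Let alu : B al u = 0. Proof. by rewrite alE // omega_diag. Qed.

(** Since [B u b = 0], only the [be]-term of the expansion of [u] in [al] and [be] survives. *)
Let be_unique be :
  be \in v -> {in v, forall z, B be z = o b z} -> u = - B u u *: be.
Proof.
move=> bev beE.
have := ker_omega_perp_pair uv bv oub PT alv bev alE beE uL.
by rewrite ub scale0r sub0r -scaleNr.
Qed.

Lemma anisotropic_dual z : z \in v -> B u z = - B u u * o b z.
Proof.
have [be bev beE] := omega_dual bv => zv.
by rewrite [in LHS](be_unique bev beE) formZl beE.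
Qed.

Lemma ker_omega_perp_anisotropic x :
  x \in L -> x = B x b *: al + (B x u / B u u) *: u.
Proof.
move=> xL; have [be bev beE] := omega_dual bv.
have beu : be = - (B u u)^-1 *: u.
  by rewrite [X in _ *: X](be_unique bev beE) scalerA mulrNN mulVf // scale1r.
have := ker_omega_perp_pair uv bv oub PT alv bev alE beE xL.
by rewrite beu scalerA mulrN scaleNr opprK.
Qed.

(** [A u] lies in [L] and is orthogonal to [u], which leaves only its [al]-component. *)
Let Au A : A \in h -> A u = B (A u) b *: al.
Proof.
move=> Ah; have AuL := derivation_ker_omega_perp PT Ah uL.
by rewrite [LHS](ker_omega_perp_anisotropic AuL) skew_form_eq0 // mul0r scale0r
  addr0.
Qed.

Lemma nondegenerate_ker_omega_perp_false : B al al != 0 -> False.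
Proof.
move=> alal; pose F := lie u al.
have Fem : B F em = B al al by rewrite alE.
have AF A : A \in h -> A F = 0.
  move=> Ah; have AalL := derivation_ker_omega_perp PT Ah alL.
  have Aal := ker_omega_perp_anisotropic AalL.
  (* Skewness removes the [al]-component of [A al]; with [A u] a multiple of [al], both terms of
     [A F] vanish. *)
  have s0 : B (A al) b = 0.
    have := skew_form_eq0 al Ah;
      rewrite {1}Aal formDl !formZl (formC B u) alu mulr0 addr0.
    by move/eqP; rewrite mulf_eq0 (negPf alal) orbF => /eqP.
  rewrite (h_derivation Ah) Au // Aal s0 scale0r add0r lieZl lieZr.
  by rewrite !lie_alternating !scaler0 addr0.
have Fd : F \in d := lie_derived u al.
have [A Ah [k [AX _]]] := geodesic_equations Fd Tv.
have k0 : k = 0.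
  have := congr1 (B^~ em) AX; rewrite (AF _ Ah) !formE (omega_derived T Fd) Fem.
  by rewrite oppr0 add0r => /eqP;
    rewrite eq_sym oppr_eq0 mulf_eq0 (negPf alal) orbF => /eqP.
(* The left side is 0, and up to sign the right side is [B al al] times the square of [Psi T]. *)
have := congr1 (B^~ (Psi T)) AX.
rewrite (AF _ Ah) k0 scale0r subr0 lie_derivedE // !formE (formC B em)
  (Psi_orth T).2 Fem.
move=> /eqP; rewrite mulr0 subr0 eq_sym oppr_eq0 mulf_eq0 (negPf alal) /=.
by move/eqP/Psi_anisotropic => PT0; move: PT; rewrite PT0 eqxx.
Qed.

Lemma degenerate_ker_omega_perp_false : B al al = 0 -> False.
Proof.
move=> alal.
have alQ : al \in Q.
  apply: (mem_ker_omega_pair oub PT alv); first by rewrite -alE.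
  have := anisotropic_dual alv; rewrite formC alu => /esym/eqP.
  by rewrite mulf_eq0 oppr_eq0 (negPf uu) => /eqP.
have Pal : Psi al = 0 := ker_omega_Psi uv bv oub alQ.
have oal : o al b = 0 by case/ker_omegaP: alQ => _ ->.
have PE := Psi_omega_pair oub.
(* [A u] is a multiple of [al], which lies in [Q], so its term drops out of [derivation_omega]. *)
have oAb A l : A \in h -> A em = l *: em -> o u (A b) = - l.
  move=> Ah Aem; have := derivation_omega u b Ah Aem.
  by rewrite (Au Ah) lieZl formZl oal mulr0 add0r oub mulr1.
(* At [em + u] one gets [A em = 0] and [B (A u) b = 1]. Skewness of [A] between [Psi u] and [Psi b]
   makes omega(A b, b) times the square of [Psi u] vanish, and omega(b, A b) is nonzero since
   [B u (A b) = -1]. *)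
have Pu : Psi u = 0.
  have [A Ah [k [Aem AE]]] := geodesic_equations emd uv.
  have k0 : k = 0.
    have := AE u uv; rewrite skew_form_eq0 // omega_diag sub0r => /esym/eqP.
    by rewrite oppr_eq0 mulf_eq0 (negPf uu) orbF => /eqP.
  have {}Aem : A em = 0 *: em by rewrite Aem lie_em k0 oppr0 !scale0r subr0.
  have Aub : B (A u) b = 1 by rewrite AE // k0 mul0r subr0.
  have PAu : Psi (A u) = 0 by rewrite (Au Ah) linearZ /= Pal scaler0.
  apply: Psi_anisotropic.
  have := derivation_Psi_form b u Ah Aem;
    have := derivation_Psi_form u b Ah Aem.
  rewrite PAu form0l !mul0r !subr0 (h_skew Ah) (formC B (Psi u)) => + /esym.
  move=> /eqP; rewrite oppr_eq0 => /eqP ->.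
  rewrite PE (oAb _ _ Ah Aem) oppr0 scale0r addr0 formZl => /eqP.
  rewrite mulf_eq0 => /orP[|/eqP //]; rewrite omegaC oppr_eq0 => oAb0.
  have := anisotropic_dual (derivation_orth_derived Ah bv).
  rewrite (eqP oAb0) mulr0 -[B u _]opprK -(h_skew Ah) Aub => /eqP.
  by rewrite oppr_eq0 oner_eq0.
have Pb : B (Psi b) (Psi b) != 0.
  apply: contra_neq PT => /Psi_anisotropic Pb.
  by rewrite PE Pu Pb !scaler0 addr0.
have PAb A l : A \in h -> A em = l *: em -> Psi (A b) = - l *: Psi b.
  by move=> Ah Aem; rewrite PE Pu scaler0 add0r (oAb _ _ Ah Aem).
(* By skewness 0 = B (A (Psi b)) (Psi b), which equals [- 2 l] times the square of [Psi b]. *)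
have Aem0 A : A \in h -> A em = 0.
  move=> Ah; have [l Aem] := derivation_em PT Ah.
  have := derivation_Psi_form b b Ah Aem.
  rewrite skew_form_eq0 // (PAb _ _ Ah Aem) formZl => H.
  have /eqP : l * B (Psi b) (Psi b) = 0 by lra.
  by rewrite mulf_eq0 (negPf Pb) orbF Aem => /eqP ->; rewrite scale0r.
(* [X] is [e1] shifted along [em] to become orthogonal to [F]; this will force [A u = 0] below. *)
pose F := lie u b; pose X := e1 - B F e1 *: em.
have Fem : B F em = 1 := oub.
have Xem : B X em = 1 by rewrite formDl formNl formZl Bem Be1m mulr0 subr0.
have FX : B F X = 0 by rewrite formDr formNr formZr Fem mulr1 subrr.
have Xd : X \in d by rewrite rpredB // memvZ.
have bX : lie b X = Psi b.
  have [_ be1 _ _] := proj2 ab b.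
  by rewrite lieDr lieNr lieZr lie_em scaler0 subr0.
clearbody X; have [A Ah [k [AX AE]]] := geodesic_equations Xd bv.
have Aem := Aem0 A Ah; have {}Aem : A em = 0 *: em by rewrite Aem scale0r.
have k0 : k = 0.
  have := congr1 (B^~ em) AX;
    rewrite (h_skew Ah) Aem bX !formE (Psi_orth b).2 Xem; lra.
have {}AX : A X = - Psi b by rewrite AX bX k0 scale0r subr0.
have Aub : B (A u) b = 0.
  rewrite (h_skew Ah) formC AE // (formC B b) ub mulr0 subr0 lieC formNl.
  by rewrite -/F FX !oppr0.
have Au0 : A u = 0 by rewrite (Au Ah) Aub scale0r.
have PAb0 : Psi (A b) = 0 by rewrite (PAb _ _ Ah Aem) oppr0 scale0r.
(* As [A u = 0], [A F] is [[u, A b]], and [Psi] kills [u] and [A b], so one term of the second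
   Jacobi identity remains. *)
have AF : B (A F) (Psi b) = 0.
  have [_] := jacobi_omega_Psi b u (A b).
  rewrite Pu PAb0 !form0l !addr0 (h_derivation Ah) Au0 lie0l add0r => <-.
  exact: formC.
(* [A (Psi b)] is a multiple of [em], and [F] and [X] both have product 1 with [em]. *)
have AFX : B (A F) (Psi b) = B (A X) (Psi b).
  rewrite !(h_skew Ah) (derivation_Psi b Ah Aem) PAb0 scale0r !sub0r.
  by rewrite oppr0 !add0r !formNr !formZr Fem Xem.
by move: Pb; rewrite -oppr_eq0 -formNl -AX -AFX AF eqxx.
Qed.

End AnisotropicVector.

(** * [L] is a totally isotropic plane; index count in v *)

Lemma ker_omega_perp_isotropic T :
  T \in v -> Psi T != 0 -> {in L, forall u, B u u = 0}.
Proof.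
move=> Tv PT u uL; apply/eqP; apply: contraT => uu.
have [uv /mem_orthovP uQ] : u \in v /\ u \in orthov B Q.
  by move: uL; rewrite memv_cap => /andP.
have uNQ : u \notin Q by apply: contraNN uu => /uQ ->.
have [b bv oub] := omega_neq0 uv uNQ.
have [al alv alE] := omega_dual uv.
(* Shifting [b] along [u] makes it orthogonal to [u] and keeps omega(u, b) = 1, because omega(u, u)
   = 0. *)
pose b' := b - (B u b / B u u) *: u.
have b'v : b' \in v by rewrite rpredB // memvZ.
have oub' : o u b' = 1 by rewrite lieDr lieNr lieZr lie_alternating scaler0
  subr0.
have ub' : B u b' = 0 by rewrite formDr formNr formZr divfK // subrr.
have [alal|alal] := eqVneq (B al al) 0.
  by case: (degenerate_ker_omega_perp_false PT uL uu b'v oub' ub' alv alE alal).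
by case: (nondegenerate_ker_omega_perp_false Tv PT uL uu b'v oub' ub' alv alE
  alal).
Qed.

(** The vectors dual to omega(a, .) and omega(b, .) span [L], and omega(a, b) = 1 makes them
    independent. *)
Lemma dim_ker_omega_perp T : Psi T != 0 -> \dim L = 2%N.
Proof.
move=> PT; have [a [b [av bv oab]]] := omega_witness.
have [al alv alE] := omega_dual av; have [be bev beE] := omega_dual bv.
have alL := mem_ker_omega_perp av alv alE;
  have beL := mem_ker_omega_perp bv bev beE.
have fr : free [:: al; be].
  rewrite free_cons span_seq1 seq1_free; apply/andP; split.
    apply/negP => /vlineP[c alc]; have := alE b bv.
    by rewrite alc formZl beE // omega_diag oab mulr0 => /eqP;
      rewrite eq_sym oner_eq0.
  apply/negP => /eqP be0; have := beE a av.
  by rewrite be0 form0l omegaC oab => /eqP; rewrite eq_sym oppr_eq0 oner_eq0.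
have -> : L = <<[:: al; be]>>%VS; last by rewrite (eqP fr).
apply/eqP; rewrite eqEsubv; apply/andP; split.
  apply/subvP => x /(ker_omega_perp_pair av bv oab PT alv bev alE beE) ->.
  by rewrite rpredB // memvZ // memv_span // !inE eqxx ?orbT.
by apply/span_subvP => x; rewrite !inE => /orP[] /eqP ->.
Qed.

Lemma ker_omega_perp_totally_isotropic T :
  T \in v -> Psi T != 0 -> totally_isotropic B L.
Proof.
move=> Tv PT x y xL yL; have iso := ker_omega_perp_isotropic Tv PT.
have := iso _ (memvD xL yL); rewrite !formE !iso // (formC B y); lra.
Qed.

(** For [x] in [L], omega(a, x) and omega(b, x) are products of [x] with vectors of the totally
    isotropic [L]. *)
Lemma ker_omega_perp_sub T : T \in v -> Psi T != 0 -> (L <= Q)%VS.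
Proof.
move=> Tv PT; have iso := ker_omega_perp_totally_isotropic Tv PT.
have [a [b [av bv oab]]] := omega_witness.
have [al alv alE] := omega_dual av; have [be bev beE] := omega_dual bv.
have alL := mem_ker_omega_perp av alv alE;
  have beL := mem_ker_omega_perp bv bev beE.
apply/subvP => x xL; have xv : x \in v by move: xL; rewrite memv_cap => /andP[].
by apply: (mem_ker_omega_pair oab PT); rewrite -?alE -?beE ?iso.
Qed.

(** Otherwise [L], which is orthogonal to [Q], would span with [x] a three-dimensional nonpositive
    subspace of v, against index 2. *)
Lemma ker_omega_posdef T x :
    T \in v -> Psi T != 0 -> has_index B v 2 -> x \in Q -> x \notin L -> 0 < B
      x x.
Proof.
move=> Tv PT v2 xQ xL; rewrite ltNge; apply: contra xL => xx;
  apply: contraT => xL.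
have xv : x \in v by case/ker_omegaP: xQ.
have x0 : x != 0 by apply: contraNneq xL => ->; rewrite mem0v.
have LxV : (L + <[x]> <= v)%VS by rewrite subv_add -memvE xv capvSl.
have/(dim_nonpos_le_index orth_derived_nondegenerate v2 LxV) :
    {in (L + <[x]>)%VS, forall y, B y y <= 0}.
  move=> _ /memv_addP[y yL [_ /vlineP[c ->] ->]].
  have yx : B y x = 0 by move: yL; rewrite memv_cap => /andP[_ /mem_orthovP ->].
  rewrite !formE (formC B x) yx (ker_omega_perp_isotropic Tv PT yL) !mulr0
    !add0r.
  by rewrite mulrA -expr2 mulr_ge0_le0 // sqr_ge0.
rewrite dimv_disjoint_sum ?(dim_ker_omega_perp PT) ?dim_vline ?x0 //.
apply/eqP; rewrite -subv0; apply/subvP => y /memv_capP[+ /vlineP[c yc]].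
rewrite yc; have [->|c0] := eqVneq c 0; first by rewrite scale0r !mem0v.
by move=> /(memvZ c^-1); rewrite scalerA mulVf // scale1r (negPf xL).
Qed.

(** The isotropic plane [L] forces [k] to be at least 2; the same bound of isotropic dimensions by
    [k] then makes [L] maximal. *)
Lemma three_step_structure k T :
    T \in v -> Psi T != 0 -> has_index B v k -> (k <= 2)%N ->
  [/\ k = 2%N, (L <= Q <= v)%VS,
      {in h, forall A : 'End(n), (A @: L <= L)%VS},
      \dim L = 2%N /\ max_totally_isotropic B v L &
      posdef_quotient B Q L].
Proof.
move=> Tv PT v_index k_le2.
have dimL := dim_ker_omega_perp PT.
have isoL := ker_omega_perp_totally_isotropic Tv PT.
have dim_iso U : (U <= v)%VS -> totally_isotropic B U -> (\dim U <= k)%N.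
  move=> Uv isoU.
  apply: (dim_nonpos_le_index orth_derived_nondegenerate v_index Uv) => x xU.
  by rewrite isoU.
have k2 : k = 2%N.
  by apply/eqP; rewrite eqn_leq k_le2 -dimL dim_iso // capvSl.
split=> //.
- by rewrite (ker_omega_perp_sub Tv PT) capvSl.
- move=> A Ah; apply/subvP => _ /memv_imgP[x xL ->].
  exact: derivation_ker_omega_perp PT Ah xL.
- split=> //; split=> // [|U /andP[LU Uv] isoU]; first exact: capvSl.
  by apply/eqP; rewrite eq_sym eqEdim LU dimL -k2 dim_iso.
split; first exact: capvSr.
by rewrite k2 in v_index => x xQ xL; apply: (ker_omega_posdef Tv PT).
Qed.

End AdaptedBasis.
End GeodesicOrbitTheory.

Theorem theorem2 (R : realType) (n : lieAlgType R) (B : {symmetric n})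
    (h : {vspace 'End(n)}) (k : nat)
    (n_nilpotent : nilpotent_lie n)
    (B_nondegenerate : nondegenerate B)
    (h_lie : lie_subalgebra_End h)
    (h_derivation : {in h, forall A, derivation A})
    (h_skew : {in h, forall A, skew_adjoint B A})
    (GO : geodesic_orbit B h)
    (d_nondegenerate : nondegenerate_on B (derived n))
    (d_lorentzian : lorentzian B (derived n))
    (v_index : has_index B (orth_derived B) k)
    (v_index_le2 : (k <= 2)%N) :
  (exists e1 w em Psi, adapted_basis B e1 w em Psi) /\
  forall e1 w em Psi, adapted_basis B e1 w em Psi ->
    let Q := ker_omega B em in
    let L := ker_omega_perp B em in
    nilpotent_step n 2%N \/
    [/\ k = 2%N, (L <= Q <= orth_derived B)%VS,
        {in h, forall A : 'End(n), (A @: L <= L)%VS},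
        \dim L = 2%N /\ max_totally_isotropic B (orth_derived B) L &
        posdef_quotient B Q L].
Proof.
split; first exact: (adapted_basis_exists n_nilpotent h_derivation h_skew GO).
move=> e1 w em Psi ab Q L.
have [|[T Tv PT]] := two_step_or_Psi_neq0 d_nondegenerate d_lorentzian ab.
  by left.
by right; apply: (three_step_structure n_nilpotent _ _ _ _ _ _ ab Tv PT).
Qed.
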